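(* Let $M'\ge 1$ and $D\ge 1$ be integers, let $\boldsymbol{\Sigma}_k$ be a known invertible $M'D\times M'D$ covariance matrix which is block-diagonal with $M'\times M'$ diagonal blocks $\boldsymbol{\Sigma}^1,\dots,\boldsymbol{\Sigma}^D$ and zero off-diagonal blocks, and let $\boldsymbol{u}$ be the $M'D\times D$ design matrix with size-$M'$ vectors of ones along the diagonal and zeros elsewhere. Suppose that, given the unknown parameter $\boldsymbol{\theta}_k\in\mathbb{R}^D$, the vector of expert estimates $\boldsymbol{\mu}_k\in\mathbb{R}^{M'D}$ has distribution $\mathcal{N}(\boldsymbol{u}\boldsymbol{\theta}_k,\boldsymbol{\Sigma}_k)$, and assume a flat (improper, constant) prior distribution on $\boldsymbol{\theta}_k$. Then the posterior distribution $h(\boldsymbol{\theta}_k\mid\boldsymbol{\mu}_k)$ of $\boldsymbol{\theta}_k$ given $\boldsymbol{\mu}_k$ is the Gaussian distribution $$h(\boldsymbol{\theta}_k\mid\boldsymbol{\mu}_k)\sim\mathcal{N}\big(\boldsymbol{\mathcal{A}}_k^{-1}\boldsymbol{\mathcal{B}}_k,\ \boldsymbol{\mathcal{A}}_k^{-1}\big),$$ where $\boldsymbol{\mathcal{A}}_k=\boldsymbol{u}^T\boldsymbol{\Sigma}_k^{-1}\boldsymbol{u}$ and $\boldsymbol{\mathcal{B}}_k=\boldsymbol{u}^T\boldsymbol{\Sigma}_k^{-1}\boldsymbol{\mu}_k$.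
   Context: The design matrix $\boldsymbol{u}$ is the block matrix whose $d$-th column has ones exactly in rows $(d-1)M'+1,\dots,dM'$ and zeros in all other rows. The vector $\boldsymbol{\mu}_k=(\boldsymbol{\mu}^1,\dots,\boldsymbol{\mu}^D)^T$ stacks the vectors $\boldsymbol{\mu}^d=(\mu_1^d,\dots,\mu_{M'}^d)^T$, where $\mu_j^d$ is the estimate of the $d$-th coordinate of $\boldsymbol{\theta}_k$ by the $j$-th of $M'$ experts. With a flat prior, the posterior density is by definition the likelihood normalized as a function of the parameter: if $f(\boldsymbol{\mu}\mid\boldsymbol{\theta})$ is the density at $\boldsymbol{\mu}$ of $\mathcal{N}(\boldsymbol{u}\boldsymbol{\theta},\boldsymbol{\Sigma}_k)$, then $h(\boldsymbol{\theta}\mid\boldsymbol{\mu})=f(\boldsymbol{\mu}\mid\boldsymbol{\theta})\big/\int_{\mathbb{R}^D}f(\boldsymbol{\mu}\mid\boldsymbol{\theta}')\,d\boldsymbol{\theta}'$. A covariance matrix is symmetric positive semidefinite, hence positive definite when invertible. $\mathcal{N}(m,S)$ denotes the multivariate Gaussian distribution with mean $m$ and covariance matrix $S$. The index $k$ only labels the collection of experts considered. *)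

(* Defs.v *)
From HB Require Import structures.
From mathcomp Require Import all_boot all_order all_algebra.
From mathcomp Require Import all_classical all_reals all_analysis.

Set Implicit Arguments.
Unset Strict Implicit.
Unset Printing Implicit Defensive.

Import Order.TTheory GRing.Theory Num.Theory.
Import numFieldNormedType.Exports.

Local Open Scope classical_set_scope.
Local Open Scope ring_scope.

(* The product of [mu] and [nu], carried over from [T * n.-tuple T] to tuples of
   length [n.+1]. *)
Section measure_cons.
Context (R : realType) d (T : measurableType d) (n : nat).

Definition tcons (p : T * n.-tuple T) : n.+1.-tuple T :=
  [the n.+1.-tuple T of p.1 :: p.2].

Lemma measurable_tcons : measurable_fun setT tcons.
Proof. by apply: measurable_cons. Qed.

Variable mu : {sigma_finite_measure set T -> \bar R}.
Variable nu : {sigma_finite_measure set (n.-tuple T) -> \bar R}.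

Definition measure_cons : set (n.+1.-tuple T) -> \bar R :=
  pushforward (mu \x nu)%E tcons.

Let measure_cons0 : measure_cons set0 = 0%E.
Proof. by rewrite /measure_cons /pushforward preimage_set0 measure0. Qed.

Let measure_cons_ge0 A : (0 <= measure_cons A)%E.
Proof. by rewrite /measure_cons /pushforward measure_ge0. Qed.

Let measure_cons_sigma_additive : semi_sigma_additive measure_cons.
Proof.
move=> F mF tF mUF; rewrite /measure_cons /pushforward preimage_bigcup.
apply: measure_semi_sigma_additive.
- by move=> i; rewrite -[X in measurable X]setTI; exact: measurable_tcons.
- apply/trivIsetP => /= i j _ _ ij; rewrite -preimage_setI.
  by move/trivIsetP : tF => /(_ _ _ _ _ ij) ->//; rewrite preimage_set0.
- by rewrite -preimage_bigcup -[X in measurable X]setTI; exact: measurable_tcons.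
Qed.

HB.instance Definition _ := isMeasure.Build _ _ _ measure_cons
  measure_cons0 measure_cons_ge0 measure_cons_sigma_additive.

Let measure_cons_sigma_finite : sigma_finite setT measure_cons.
Proof.
have /sigma_finiteP[F [UF ndF mF]] := sigma_finiteT mu.
have /sigma_finiteP[G [UG ndG mG]] := sigma_finiteT nu.
pose g (t : n.+1.-tuple T) : T * n.-tuple T := (thead t, [tuple of behead t]).
have mg : measurable_fun setT g.
  apply: measurable_fun_pair; first exact: measurable_tnth.
  exact: measurable_behead.
have gK t : g (tcons t) = t by case: t => a b; congr pair; exact/val_inj.
exists (fun k => g @^-1` (F k `*` G k)) => [|k].
  rewrite -preimage_bigcup (_ : \bigcup_k _ = setT) ?preimage_setT//.
  apply/seteqP; split=> // -[a t] _.
  have [i _ Fa] : (\bigcup_i F i) a by rewrite -UF.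
  have [j _ Gt] : (\bigcup_i G i) t by rewrite -UG.
  exists (maxn i j) => //; split.
    by move: a Fa; exact/subsetPset/ndF/leq_maxl.
  by move: t Gt; exact/subsetPset/ndG/leq_maxr.
have [mFk Fkoo] := mF k; have [mGk Gkoo] := mG k.
have mFG : measurable (F k `*` G k) by exact: measurableX.
split; first by rewrite -[X in measurable X]setTI; exact: mg.
rewrite /measure_cons /pushforward -comp_preimage.
rewrite (_ : g \o tcons = id); last by apply/funext => t; exact: gK.
by rewrite preimage_id product_measure1E// lte_mul_pinfty// ge0_fin_numE.
Qed.

HB.instance Definition _ := Measure_isSigmaFinite.Build _ _ _ measure_cons
  measure_cons_sigma_finite.

End measure_cons.

Section lebesgue_tuple.
Context (R : realType).
Let RR := measurableTypeR R.

(* Lebesgue measure on R^n, with R^n represented by the measurable type of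
   n-tuples (product sigma-algebra of the Borel sets of R). *)
Fixpoint lebesgue_tuple n : {sigma_finite_measure set (n.-tuple RR) -> \bar R} :=
  match n with
  | 0 => \d_([tuple] : 0.-tuple RR)
  | n'.+1 => measure_cons (@lebesgue_measure R) (lebesgue_tuple n')
  end.

Lemma lebesgue_tuple_box n (B : 'I_n -> set RR) :
  (forall i, measurable (B i)) ->
  lebesgue_tuple n [set x | forall i, B i (tnth x i)] =
  (\prod_(i < n) lebesgue_measure (B i))%E.
Proof.
elim: n B => [|n IHn] B mB.
  rewrite big_ord0 /= diracE mem_set //; by case.
rewrite big_ord_recl -IHn // -product_measure1E //; last first.
  rewrite (_ : [set x | _] =
      \bigcap_(i in [set: 'I_n]) ((@tnth n RR)^~ i @^-1` B (lift ord0 i))).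
    apply: fin_bigcap_measurable => // i _.
    by rewrite -[X in measurable X]setTI; exact: measurable_tnth.
  by apply/seteqP; split => x /= Bx i; [move=> _; exact: Bx|exact: Bx].
rewrite /= /measure_cons /pushforward; congr (_ _); apply/seteqP.
split=> -[a t] /= => [Bat|[Ba Bt] i].
  split; first exact: (Bat ord0).
  by move=> i; have := Bat (lift ord0 i); rewrite tnthS.
case: (unliftP ord0 i) => [j|] -> //.
by rewrite tnthS; exact: Bt.
Qed.

End lebesgue_tuple.

Section gaussian.
Context (R : realType).
Local Notation RR := (measurableTypeR R).

Definition cv_of_tuple n (x : n.-tuple RR) : 'cV[R]_n := \col_i tnth x i.

Definition covariance_mx n (S : 'M[R]_n) : Prop :=
  S^T = S /\ forall x : 'cV[R]_n, 0 <= (x^T *m S *m x) 0 0.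

(* Meaningful when [S] is an invertible covariance matrix only; see
   [gaussian_distribution]. *)
Definition gaussian_pdf n (m : 'cV[R]_n) (S : 'M[R]_n) (x : 'cV[R]_n) : R :=
  (Num.sqrt ((2 * pi) ^+ n * \det S))^-1 *
  expR (- ((x - m)^T *m invmx S *m (x - m)) 0 0 / 2).

(* The set function [P] on R^n is the nondegenerate distribution N(m, S). *)
Definition gaussian_distribution n (P : set (n.-tuple RR) -> \bar R)
    (m : 'cV[R]_n) (S : 'M[R]_n) : Prop :=
  [/\ covariance_mx S, S \in unitmx &
      forall B, measurable B ->
        P B = (\int[lebesgue_tuple R n]_(x in B)
                 (gaussian_pdf m S (cv_of_tuple x))%:E)%E].

End gaussian.

Section flat_prior.
Context (R : realType) (n p : nat).
Local Notation RR := (measurableTypeR R).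

(* [f theta y] is the likelihood, i.e. the density at [y] of the observation
   given the parameter [theta]. *)
Variable f : 'cV[R]_p -> 'cV[R]_n -> R.

Definition flat_posterior_pdf (y : 'cV[R]_n) (theta : 'cV[R]_p) : R :=
  f theta y / \int[lebesgue_tuple R p]_t f (cv_of_tuple t) y.

Definition flat_posterior (y : 'cV[R]_n) (B : set (p.-tuple RR)) : \bar R :=
  (\int[lebesgue_tuple R p]_(t in B)
     (flat_posterior_pdf y (cv_of_tuple t))%:E)%E.

End flat_prior.

Section design.
Context (R : realType) (M D : nat).

(* [D] blocks of [M] rows, the rows of the block [d] being all equal to the
   [d]-th unit row vector. *)
Definition design_mx : 'M[R]_(\sum_(d < D) M, D) :=
  \mxcol_(d < D) \matrix_(j < M, e < D) (e == d)%:R.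

Lemma design_mxE (i : 'I_(\sum_(d < D) M)) (e : 'I_D) :
  design_mx i e = ((e * M <= i < e.+1 * M)%N)%:R.
Proof.
rewrite mxE mxE; congr (_%:R); congr nat_of_bool.
have sumM (k : 'I_D) : (\sum_(d < D | (d < k)%N) M = k * M)%N.
  by rewrite -(big_ord_widen _ (fun=> M) (ltnW (ltn_ord k))) sum_nat_const card_ord.
rewrite [in RHS](tagnat.rect i) sumM.
set k := tagnat.sig1 i; set j := tagnat.sig2 i.
have jM : (j < M)%N := ltn_ord j.
have [ek|ke|/val_inj ->] := ltngtP e k.
- rewrite (_ : (e == k) = false); last by apply/eqP => ke; rewrite ke ltnn in ek.
  apply/esym/negbTE; rewrite negb_and -!leqNgt -ltnNge; apply/orP; right.
  by rewrite (leq_trans _ (leq_addr _ _))// leq_mul2r ek orbT.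
- rewrite (_ : (e == k) = false); last by apply/eqP => ek; rewrite ek ltnn in ke.
  apply/esym/negbTE; rewrite negb_and -!leqNgt -ltnNge; apply/orP; left.
  apply: (@leq_trans (k.+1 * M)%N); last by rewrite leq_mul2r ke orbT.
  by rewrite mulSn addnC ltn_add2r.
- by rewrite eqxx leq_addr mulSn addnC ltn_add2r.
Qed.

End design.

(* Main.v *)
(* Completing the square shows that the likelihood, as a function of [theta], is
   a positive constant times the density of N(A^-1 B, A^-1); the constant is
   positive because the determinant of a positive definite matrix is. As [Sigma]
   is block-diagonal, [A] is diagonal, so this density is a product of univariate
   normal densities and its integral is 1 by Tonelli's theorem. *)
Require Import Defs.
From mathcomp Require Import all_boot all_order all_algebra.
From mathcomp Require Import all_classical all_reals all_analysis.
From mathcomp Require Import measurable_realfun ring.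
Import Order.TTheory GRing.Theory Num.Theory.
Local Open Scope ring_scope.

(** * Positive definiteness of invertible covariance matrices *)

Section positive_definite.
Context (R : realType).

Lemma trmxM_ge0 n (x : 'cV[R]_n) : 0 <= (x^T *m x) 0 0.
Proof. by rewrite mxE sumr_ge0// => i _; rewrite mxE -expr2 sqr_ge0. Qed.

Lemma trmxM_eq0 n (x : 'cV[R]_n) : ((x^T *m x) 0 0 == 0) = (x == 0).
Proof.
apply/idP/idP => [|/eqP ->]; last by rewrite mulmx0 mxE.
rewrite mxE psumr_eq0 => [/allP x0|i _]; last by rewrite mxE -expr2 sqr_ge0.
apply/eqP/matrixP => i j; rewrite ord1 mxE; apply/eqP.
by have := x0 i (mem_index_enum _); rewrite mxE -expr2 sqrf_eq0.
Qed.

(** A zero of the form would be a minimum, which forces [S *m x = 0]; invertibility then gives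
    [x = 0]. *)
Lemma covariance_mx_gt0 n (S : 'M[R]_n) (x : 'cV[R]_n) :
  covariance_mx S -> S \in unitmx -> x != 0 -> 0 < (x^T *m S *m x) 0 0.
Proof.
move=> [Ssym Sge0] Su x0; rewrite lt_def Sge0 andbT; apply: contra x0 => /eqP Sx0.
set y := S *m x; set c := (y^T *m y) 0 0; set s := (y^T *m S *m y) 0 0.
(* The nonnegative quadratic [t |-> (x + t y)^T S (x + t y) = 2 t c + t^2 s]
   has no constant term, hence no linear term. *)
have addE (P Q : 'M[R]_1) : (P + Q) 0 0 = P 0 0 + Q 0 0 by rewrite mxE.
have scaleE a (P : 'M[R]_1) : (a *: P) 0 0 = a * P 0 0 by rewrite mxE.
have quad t : 0 <= 2 * t * c + t ^+ 2 * s.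
  have yE : x^T *m S = y^T by rewrite /y trmx_mul Ssym.
  have := Sge0 (x + t *: y).
  rewrite [(x + _)^T]raddfD /= [(t *: y)^T]linearZ /= !(mulmxDl, mulmxDr).
  rewrite -!(scalemxAl, scalemxAr) -[y^T *m S *m x]mulmxA yE -/y.
  rewrite yE in Sx0; rewrite !(addE, scaleE) Sx0 -/c -/s => Q.
  by rewrite (_ : 2 * t * c + _ = 0 + t * c + (t * c + t * (t * s)))//; ring.
have s0 : 0 <= s := Sge0 y.
have c0 : 0 <= c := trmxM_ge0 _ y.
have {quad} : c == 0.
  (* The minimizer is [- c / s]; the shift by 1 avoids dividing by zero when [s = 0] and still gives
     a negative value unless [c = 0]. *)
  have := quad (- c / (s + 1)).
  rewrite (_ : _ + _ = - (c ^+ 2 * (s + 2) / (s + 1) ^+ 2)); last first.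
    by field; rewrite gt_eqF// ltr_wpDl.
  rewrite oppr_ge0 => cs; rewrite -sqrf_eq0 eq_le sqr_ge0 andbT.
  move: cs; rewrite ler_pdivrMr ?exprn_gt0 ?ltr_wpDl// mul0r.
  by rewrite pmulr_lle0// ltr_wpDl.
by rewrite trmxM_eq0 -[x](mulKmx Su) -/y => /eqP ->; rewrite mulmx0.
Qed.

Lemma covariance_mx_inv n (S : 'M[R]_n) :
  covariance_mx S -> S \in unitmx -> covariance_mx (invmx S).
Proof.
move=> [Ssym Sge0] Su; split; first by rewrite trmx_inv Ssym.
move=> x; have := Sge0 (invmx S *m x).
by rewrite trmx_mul trmx_inv Ssym -!mulmxA mulKVmx.
Qed.

Lemma covariance_mx_congr n p (S : 'M[R]_n) (u : 'M[R]_(n, p)) :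
  covariance_mx S -> covariance_mx (u^T *m S *m u).
Proof.
move=> [Ssym Sge0]; split; first by rewrite !trmx_mul trmxK Ssym mulmxA.
by move=> x; have := Sge0 (u *m x); rewrite trmx_mul !mulmxA.
Qed.

(* The determinant does not vanish along the segment from the identity to [S],
   hence keeps its sign. *)
Lemma det_covariance_mx_gt0 n (S : 'M[R]_n) :
  covariance_mx S -> S \in unitmx -> 0 < \det S.
Proof.
move=> Scov Su; rewrite ltNge; apply/negP => detS0.
pose p : {poly R} := \det ((1 - 'X)%:M + 'X *: map_mx polyC S).
have pE t : p.[t] = \det ((1 - t)%:M + t *: S).
  rewrite -horner_evalE -det_map_mx; congr (\det _); apply/matrixP => i j.
  rewrite !mxE /= horner_evalE !hornerE /=.
  by case: eqVneq => _ /=; rewrite ?mulr1n ?mulr0n !hornerE.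
(* The sign change is from nonpositive to nonnegative for [- p], whose values at 0 and 1 are [-1]
   and [- \det S]. *)
have := @poly_ivt R (- p) 0 1 ler01.
rewrite !hornerN !pE subr0 scale0r addr0 det1 subrr scale1r raddf0 add0r.
rewrite oppr_ge0 detS0 lerN10 => /(_ isT)[t /andP[t0 t1]].
rewrite rootN rootE pE => /det0P[v v0 vS0].
have := congr1 (fun w : 'rV_n => (w *m v^T) 0 0) vS0.
rewrite mulmxDr mulmxDl mul_mx_scalar -scalemxAr -!scalemxAl mul0mx !mxE.
set a := \sum_j _; set b := \sum_j _ => ab0.
have vT0 : v^T != 0 by rewrite -(inj_eq (@trmx_inj _ _ _)) trmxK trmx0.
have a0 : 0 < a.
  have -> : a = (v^T^T *m v^T) 0 0 by rewrite trmxK mxE.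
  by rewrite lt_def trmxM_ge0 trmxM_eq0 vT0.
have b0 : 0 < b.
  have -> : b = (v^T^T *m S *m v^T) 0 0 by rewrite trmxK mxE.
  exact: covariance_mx_gt0.
(* In [(1 - t) * a + t * b = 0] both terms are nonnegative; the first is positive at [t = 0], the
   second for [t > 0]. *)
move: t0; rewrite le_eqVlt => /orP[/eqP t0|t0]; move: ab0.
  by rewrite -t0 subr0 mul1r mul0r addr0 => a00; rewrite a00 ltxx in a0.
apply/eqP; rewrite gt_eqF// ltr_wpDl ?mulr_gt0// mulr_ge0 ?(ltW a0)//.
by rewrite subr_ge0.
Qed.

End positive_definite.

(** * Integration of Gaussian densities with diagonal covariance *)

Section gaussian_integral.
Context (R : realType).
Local Notation RR := (measurableTypeR R).

(** By induction: the measure in dimension [n.+1] is the image of a product measure under [tcons],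
    so Tonelli splits off the head coordinate. *)
Lemma integral_lebesgue_tuple_prod n (g : 'I_n -> RR -> R) :
  (forall i, measurable_fun setT (g i)) -> (forall i x, 0 <= g i x) ->
  (\int[lebesgue_tuple R n]_t (\prod_(i < n) g i (tnth t i))%:E =
   \prod_(i < n) \int[@lebesgue_measure R]_x (g i x)%:E)%E.
Proof.
elim: n g => [|n IHn] g mg g0.
  under eq_integral do rewrite big_ord0.
  by rewrite big_ord0 integral_cst//= mul1e diracT.
have mG k (h : 'I_k -> RR -> R) : (forall i, measurable_fun setT (h i)) ->
    measurable_fun setT
      (fun t : k.-tuple RR => (\prod_(i < k) h i (tnth t i))%:E).
  move=> mh; apply/measurable_EFinP; apply: measurable_prod => i _.
  by apply: (measurableT_comp (mh i)); exact: measurable_tnth.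
have G0 k (h : 'I_k -> RR -> R) (t : k.-tuple RR) : (forall i x, 0 <= h i x) ->
    (0 <= (\prod_(i < k) h i (tnth t i))%:E)%E.
  by move=> h0; rewrite lee_fin prodr_ge0.
rewrite [LHS]ge0_integral_pushforward//=; last 3 first.
- exact: measurable_tcons.
- exact: mG.
- by move=> t _; exact: G0.
rewrite preimage_setT fubini_tonelli1/=; last 2 first.
- apply: (measurableT_comp (mG _ g mg)); exact: measurable_tcons.
- by move=> x; exact: G0.
rewrite big_ord_recl -IHn//.
rewrite -ge0_integralZr//; last 3 first.
- exact/measurable_EFinP.
- by move=> x _; rewrite lee_fin.
- by apply: integral_ge0 => t _; rewrite lee_fin prodr_ge0.
apply: eq_integral => x _; rewrite /fubini_F /=.
rewrite -ge0_integralZl//; last 3 first.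
- exact: (mG _ (fun i => g (lift ord0 i))).
- by move=> t _; rewrite lee_fin prodr_ge0.
- by rewrite lee_fin.
apply: eq_integral => t _; rewrite -EFinM; congr EFin.
rewrite big_ord_recl; congr (_ * _).
by apply: eq_bigr => i _; rewrite tnthS.
Qed.

Lemma invmx_diag n (v : 'rV[R]_n) : (forall i, v 0 i != 0) ->
  invmx (diag_mx v) = diag_mx (\row_i (v 0 i)^-1).
Proof.
move=> v0; have vV : diag_mx v *m diag_mx (\row_i (v 0 i)^-1) = 1%:M.
  apply/matrixP => i j; rewrite mulmx_diag !mxE.
  by rewrite divff.
have [vu _] := mulmx1_unit vV.
by apply: (can_inj (mulKmx vu)); rewrite vV mulmxV.
Qed.

Lemma sqrtr_prod n (v : 'I_n -> R) : (forall i, 0 <= v i) ->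
  Num.sqrt (\prod_(i < n) v i) = \prod_(i < n) Num.sqrt (v i).
Proof.
elim: n v => [|n IHn] v v0; first by rewrite !big_ord0 sqrtr1.
by rewrite !big_ord_recl sqrtrM// IHn.
Qed.

(** The determinant is a product and the quadratic form a sum over coordinates. The square root
    appears because [normal_pdf] takes a standard deviation. *)
Lemma gaussian_pdf_diag n (m : 'cV[R]_n) (v : 'rV[R]_n) (x : 'cV[R]_n) :
  (forall i, 0 < v 0 i) ->
  gaussian_pdf m (diag_mx v) x =
  \prod_(i < n) normal_pdf (m i 0) (Num.sqrt (v 0 i)) (x i 0).
Proof.
move=> v0; have v0n i : v 0 i != 0 by rewrite gt_eqF.
rewrite /gaussian_pdf invmx_diag// det_diag.
rewrite -[in X in _ ^+ X](card_ord n) -prodr_const -big_split /=.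
rewrite sqrtr_prod; last first.
  by move=> i; rewrite mulr_ge0 ?(ltW (v0 _))// mulr_ge0 ?pi_ge0.
rewrite -prodfV mul_mx_diag [(_ *m _) 0 0]mxE -sumrN big_distrl /= expR_sum -big_split /=.
apply: eq_bigr => i _.
rewrite normal_pdfE ?gt_eqF ?sqrtr_gt0// /normal_peak /normal_fun.
rewrite sqr_sqrtr ?(ltW (v0 _))//; congr (_ * expR _).
  by congr (Num.sqrt _)^-1; ring.
rewrite !mxE; field; exact: v0n.
Qed.

Lemma measurable_gaussian_pdf_diag n (m : 'cV[R]_n) (v : 'rV[R]_n) :
  (forall i, 0 < v 0 i) ->
  measurable_fun setT
    (fun t : n.-tuple RR => gaussian_pdf m (diag_mx v) (cv_of_tuple t)).
Proof.
move=> v0; under eq_fun do rewrite gaussian_pdf_diag//.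
apply: measurable_prod => i _; under eq_fun do rewrite mxE.
apply: (measurableT_comp (measurable_normal_pdf _ _)).
exact: measurable_tnth.
Qed.

Lemma integral_gaussian_pdf_diag n (m : 'cV[R]_n) (v : 'rV[R]_n) :
  (forall i, 0 < v 0 i) ->
  (\int[lebesgue_tuple R n]_t
     (gaussian_pdf m (diag_mx v) (cv_of_tuple t))%:E = 1)%E.
Proof.
move=> v0; pose g i : RR -> R := normal_pdf (m i 0) (Num.sqrt (v 0 i)).
transitivity (\int[lebesgue_tuple R n]_t (\prod_(i < n) g i (tnth t i))%:E)%E.
  apply: eq_integral => t _; rewrite gaussian_pdf_diag//; congr EFin.
  by apply: eq_bigr => i _; rewrite mxE.
rewrite integral_lebesgue_tuple_prod.
- by rewrite big1// => i _; rewrite integral_normal_pdf.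
- by move=> i; exact: measurable_normal_pdf.
- by move=> i x; exact: normal_pdf_ge0.
Qed.

End gaussian_integral.

(** * The Gaussian likelihood as a function of the parameter *)

Section likelihood.
Context (R : realType).

(** The hypothesis on [m] is the normal equation of weighted least squares. It rewrites one cross
    term, and its transpose, by symmetry of [C], the other. *)
Lemma complete_square n p (C : 'M[R]_n) (u : 'M[R]_(n, p)) (y : 'cV[R]_n)
    (m theta : 'cV[R]_p) :
  C^T = C -> u^T *m C *m u *m m = u^T *m C *m y ->
  (y - u *m theta)^T *m C *m (y - u *m theta) =
  (theta - m)^T *m (u^T *m C *m u) *m (theta - m) +
  (y^T *m C *m y - m^T *m (u^T *m C *m y)).
Proof.
move=> Csym mE.
have mTE : m^T *m u^T *m C *m u = y^T *m C *m u.
  by have := congr1 trmx mE; rewrite !trmx_mul !trmxK Csym !mulmxA.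
rewrite -mE !linearB /= !trmx_mul !mulmxBl !mulmxA mTE.
have mE' : theta^T *m u^T *m C *m y = theta^T *m u^T *m C *m u *m m.
  by have := congr1 (mulmx theta^T) mE; rewrite !mulmxA => ->.
rewrite mE'.
by apply/matrixP => i j; rewrite !mxE; ring.
Qed.

Lemma gaussian_likelihood n p (S : 'M[R]_n) (u : 'M[R]_(n, p)) (y : 'cV[R]_n) :
  let A := u^T *m invmx S *m u in
  let B := u^T *m invmx S *m y in
  covariance_mx S -> S \in unitmx -> A \in unitmx ->
  exists2 K : R, 0 < K & forall theta,
    gaussian_pdf (u *m theta) S y =
    K * gaussian_pdf (invmx A *m B) (invmx A) theta.
Proof.
move=> A B Scov Su Au; set m := invmx A *m B.
have Vcov : covariance_mx (invmx A).
  by apply: covariance_mx_inv => //; apply/covariance_mx_congr/covariance_mx_inv.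
have norm_gt0 k (V : 'M[R]_k) : covariance_mx V -> V \in unitmx ->
    0 < Num.sqrt ((2 * pi) ^+ k * \det V).
  move=> cV uV; rewrite sqrtr_gt0 mulr_gt0 ?det_covariance_mx_gt0//.
  by rewrite exprn_gt0// mulr_gt0// pi_gt0.
pose c := (y^T *m invmx S *m y - m^T *m B) 0 0.
(* The ratio of the two normalizing constants, times the exponential of the part of the completed
   square that is free of [theta]. *)
exists (Num.sqrt ((2 * pi) ^+ p * \det (invmx A)) /
        Num.sqrt ((2 * pi) ^+ n * \det S) * expR (- c / 2)).
  by rewrite mulr_gt0 ?expR_gt0// divr_gt0 ?norm_gt0 ?unitmx_inv.
move=> theta; rewrite /gaussian_pdf invmxK.
rewrite (complete_square _ _ _ _ _ m); last 2 first.
- by rewrite trmx_inv Scov.1.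
- by rewrite -/A mulKVmx.
rewrite -/A -/B [fun_of_matrix (_ + (_ - _)) 0 0]mxE -/c opprD.
rewrite [in X in expR X]mulrDl expRD.
by field; rewrite !gt_eqF// norm_gt0// unitmx_inv.
Qed.

End likelihood.

(** * The precision matrix of the block design *)

Section design.
Context (R : realType) (M D : nat).

Lemma design_precision_diag (S_ : 'I_D -> 'M[R]_M) :
  let S := \mxdiag_(d < D) S_ d in
  let A := (design_mx R M D)^T *m invmx S *m design_mx R M D in
  S \in unitmx -> A = diag_mx (\row_d A d d).
Proof.
move=> S A Su; set u := design_mx R M D in A *.
(* [Z] commutes with [S] and is intertwined by [u] with a diagonal matrix whose
   entries are distinct, so [A] commutes with the latter. *)
pose Z : 'M[R]_(\sum_(d < D) M) := \mxdiag_(d < D) (d%:R)%:M.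
pose Delta : 'M[R]_D := diag_mx (\row_d d%:R).
have ZS : Z *m S = S *m Z.
  rewrite /Z /S {2}/mxdiag mul_mxdiag_mxblock mul_mxblock_mxdiag.
  apply/eq_mxblock => i j; rewrite mul_scalar_mx mul_mx_scalar.
  by case: eqVneq => [->//|_]; rewrite !scaler0.
have Zu : Z *m u = u *m Delta.
  rewrite /Z /u /design_mx mul_mxdiag_mxcol mxcol_mul.
  apply/eq_mxcol => d; rewrite mul_scalar_mx mul_mx_diag.
  apply/matrixP => i j; rewrite !mxE; case: eqVneq => [->|_].
    by rewrite mulrC.
  by rewrite mulr0 mul0r.
have ZT : Z^T = Z.
  by rewrite /Z tr_mxdiag; apply: eq_mxdiag => d; rewrite tr_scalar_mx.
have ZV : Z *m invmx S = invmx S *m Z.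
  apply: (can_inj (mulKmx Su)).
  by rewrite mulKVmx// mulmxA -ZS mulmxK.
have AD : Delta *m A = A *m Delta.
  have uZ : u^T *m Z = Delta *m u^T.
    by have := congr1 trmx Zu; rewrite !trmx_mul ZT tr_diag_mx.
  rewrite /A -[RHS]mulmxA -Zu !mulmxA -uZ.
  by rewrite -2!mulmxA [Z *m (_ *m _)]mulmxA ZV !mulmxA.
clearbody A; apply/matrixP => d e; rewrite !mxE; case: (eqVneq d e) => [->//|de].
(* This entry of the commutation relation amounts to [A d e * (d%:R - e%:R) = 0]. *)
have := congr1 (fun B : 'M[R]_D => B d e) AD.
rewrite mul_diag_mx mul_mx_diag !mxE => /eqP.
rewrite mulrC -subr_eq0 -mulrBr mulf_eq0 subr_eq0 eqr_nat.
case/orP => [/eqP->|/eqP/val_inj/eqP].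
  by rewrite mulr0n.
by rewrite (negbTE de).
Qed.

(** The first row of block [e] holds a one. This makes the diagonal entries of the precision matrix
    positive. *)
Lemma design_mx_col_neq0 (e : 'I_D) : (1 <= M)%N -> col e (design_mx R M D) != 0.
Proof.
move=> M0; apply/eqP => /matrixP/(_ (tagnat.Rank e (Ordinal M0)) 0).
rewrite !mxE tagnat.Rank1K eqxx => /eqP.
by rewrite oner_eq0.
Qed.

End design.

Theorem lemma2 (R : realType) (M D : nat) (hM : (1 <= M)%N) (hD : (1 <= D)%N)
  (Sigma : 'M[R]_(\sum_(d < D) M)) (Sigma_ : 'I_D -> 'M[R]_M)
  (Sigma_blocks : Sigma = \mxdiag_(d < D) Sigma_ d)
  (Sigma_cov : covariance_mx Sigma) (Sigma_inv : Sigma \in unitmx)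
  (mu_ : 'I_D -> 'cV[R]_M) :
  let mu := \mxcol_(d < D) mu_ d in
  let u := design_mx R M D in
  let f := fun (theta : 'cV[R]_D) (y : 'cV[R]_(\sum_(d < D) M)) =>
    gaussian_pdf (u *m theta) Sigma y in
  let A := u^T *m invmx Sigma *m u in
  let B := u^T *m invmx Sigma *m mu in
  [/\ A \in unitmx,
      forall theta : 'cV[R]_D,
        flat_posterior_pdf f mu theta = gaussian_pdf (invmx A *m B) (invmx A) theta &
      gaussian_distribution (flat_posterior f mu) (invmx A *m B) (invmx A)].
Proof.
move=> mu u f A B.
have Vcov := covariance_mx_inv _ _ _ Sigma_cov Sigma_inv.
have A_diag : A = diag_mx (\row_d A d d).
  by rewrite /A /u Sigma_blocks; apply: design_precision_diag;
    rewrite -Sigma_blocks.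
(* A diagonal entry is the form of [invmx Sigma] at a column of [u]. *)
have A_gt0 d : 0 < A d d.
  have -> : A d d = ((col d u)^T *m invmx Sigma *m col d u) 0 0.
    by rewrite tr_col -row_mul !mxE; apply: eq_bigr => i _;
       rewrite [col _ _ _ _]mxE [row _ _ _ _]mxE.
  by apply: covariance_mx_gt0; rewrite ?unitmx_inv// design_mx_col_neq0.
have A_unit : A \in unitmx.
  rewrite A_diag unitmxE det_diag unitfE; apply/prodf_neq0 => d _.
  by rewrite mxE gt_eqF.
pose v : 'rV[R]_D := \row_d (A d d)^-1.
have v_gt0 d : 0 < v 0 d by rewrite mxE invr_gt0.
have AV : invmx A = diag_mx v.
  rewrite A_diag invmx_diag => [|d]; last by rewrite mxE gt_eqF.
  by congr diag_mx; apply/rowP => d; rewrite !mxE.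
have [K K_gt0 fE] := gaussian_likelihood _ _ _ Sigma u mu Sigma_cov Sigma_inv A_unit.
have posteriorE theta :
    flat_posterior_pdf f mu theta = gaussian_pdf (invmx A *m B) (invmx A) theta.
  (* With [K] pulled out, the remaining Gaussian integral is 1, so the denominator is [K] and
     cancels the one in the numerator. *)
  rewrite /flat_posterior_pdf /Rintegral /f fE.
  under eq_integral do rewrite fE EFinM.
  rewrite ge0_integralZl//.
  - rewrite AV integral_gaussian_pdf_diag// mule1 /=.
    by rewrite mulrAC mulfV ?mul1r// gt_eqF.
  - by apply/measurable_EFinP; rewrite AV; exact: measurable_gaussian_pdf_diag.
  - by move=> t _; rewrite lee_fin mulr_ge0 ?expR_ge0// invr_ge0 sqrtr_ge0.
  - by rewrite lee_fin ltW.
split => //; split.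
- by apply: covariance_mx_inv => //; exact: covariance_mx_congr.
- by rewrite unitmx_inv.
- by move=> E mE; apply: eq_integral => t _; rewrite posteriorE.
Qed.
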